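(* Let $\mathcal{U}$ be a Polish space, $\Theta$ a non-empty compact metric space, and $\{f_\theta:\theta\in\Theta\}$ a family of probability density functions $f_\theta:\mathcal{U}\to[0,\infty)$ with respect to a fixed Borel measure $Q$ on $\mathcal{U}$ such that $(\theta,u)\mapsto f_\theta(u)$ is upper semicontinuous from $\Theta\times\mathcal{U}$ to $\mathbb{R}$. Let $U_0,U_1,\dots$ be a stationary ergodic process with values in $\mathcal{U}$, and let $U$ have the same distribution as $U_0$. Let $\theta_n:\mathcal{U}^n\to\Theta$, $n\ge1$, be measurable functions such that, with $\hat\theta_n=\theta_n(U_0,\dots,U_{n-1})$, $$\lim_n\frac1n\sum_{i=0}^{n-1}\log f_{\hat\theta_n}(U_i)=\lim_n\sup_{\theta\in\Theta}\frac1n\sum_{i=0}^{n-1}\log f_\theta(U_i)\quad\text{with probability one}.$$ If $\mathbb{E}\sup_{\theta\in\Theta}|\log f_\theta(U)|$ is finite, then $\hat\theta_n$ converges almost surely to the non-empty set $$\Theta_0=\operatorname*{argmax}_{\theta\in\Theta}\ \mathbb{E}\log f_\theta(U).$$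
   Context: A sequence in $\Theta$ converges to a set $\Theta_0$ if the distance from its $n$-th term to $\Theta_0$ tends to $0$. The common distribution of the $U_i$ is not assumed to have a density in the family, nor to be absolutely continuous with respect to $Q$. If the supremum $\sup_{\theta\in\Theta}|\log f_\theta(U)|$ fails to be measurable, the expectation in the hypothesis is understood as an outer expectation. *)

(* Defs.v *)
From HB Require Import structures.
From mathcomp Require Import all_boot all_order all_algebra.
From mathcomp Require Import all_classical all_reals all_analysis measurable_realfun.

Set Implicit Arguments.
Unset Strict Implicit.
Unset Printing Implicit Defensive.

Import Order.TTheory GRing.Theory Num.Theory.
Import numFieldNormedType.Exports.

Local Open Scope classical_set_scope.
Local Open Scope ring_scope.

Section topology.

Definition separable (T : topologicalType) :=
  exists2 D : set T, countable D & dense D.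

Definition is_distance (R : realType) (T : Type) (dist : T -> T -> R) :=
  [/\ forall x y, 0 <= dist x y,
      forall x y, dist x y = 0 <-> x = y,
      forall x y, dist x y = dist y x &
      forall x y z, dist x z <= dist x y + dist y z].

Definition compatible_distance (R : realType) (T : topologicalType)
    (dist : T -> T -> R) :=
  forall (x : T) (A : set T),
    nbhs x A <-> exists2 e : R, 0 < e & [set y | dist x y < e] `<=` A.

Definition complete_distance (R : realType) (T : topologicalType)
    (dist : T -> T -> R) :=
  forall s : nat -> T,
    (forall e : R, 0 < e -> exists N : nat, forall m n : nat,
       (N <= m)%N -> (N <= n)%N -> dist (s m) (s n) < e) ->
    exists l : T, s n @[n --> \oo] --> l.

Definition polish (R : realType) (T : topologicalType) :=
  separable T /\
  exists dist : T -> T -> R,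
    [/\ is_distance dist, compatible_distance dist & complete_distance dist].

(* real-valued counterpart of the library's lower_semicontinuous *)
Definition upper_semicontinuous (R : realType) (X : topologicalType)
    (f : X -> R) :=
  forall (x : X) (a : R), f x < a -> \forall y \near x, f y < a.

End topology.

(* The carrier is U itself; the measurable sets are the Borel sets. *)
Notation Borel U := (g_sigma_algebraType (@open U)).

(* Theta is not required to be pointed, hence need not be a measurableType;
   this spells out measurability with respect to its Borel sigma-algebra. *)
Definition borel_measurable (d : measure_display) (T : measurableType d)
    (Y : topologicalType) (g : T -> Y) :=
  forall A : set Y, <<s @open Y >> A -> measurable (g @^-1` A).

Definition is_density (R : realType) (d : measure_display)
    (T : measurableType d) (Q : {measure set T -> \bar R}) (g : T -> R) :=
  [/\ measurable_fun [set: T] g, forall u, 0 <= g u &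
      (\int[Q]_u (g u)%:E = 1)%E].

Section process.
Variables (R : realType) (d d' : measure_display).
Variables (Omega : measurableType d) (T : measurableType d').
Variables (P : probability Omega R) (X : nat -> {RV P >-> T}).

(* product sigma-algebra on T^N *)
Definition seq_measurable : set (set (nat -> T)) :=
  <<s \bigcup_i preimage_set_system [set: nat -> T] (fun x => x i) measurable >>.

Definition seq_shift (x : nat -> T) : nat -> T := fun i => x i.+1.

Definition trajectory (w : Omega) : nat -> T := fun i => X i w.

Definition stationary := forall A : set (nat -> T), seq_measurable A ->
  P [set w | A (seq_shift (trajectory w))] = P [set w | A (trajectory w)].

Definition ergodic := forall A : set (nat -> T), seq_measurable A ->
  seq_shift @^-1` A = A ->
  P [set w | A (trajectory w)] = 0%E \/ P [set w | A (trajectory w)] = 1%E.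

Definition sample (n : nat) (w : Omega) : n.-tuple T := [tuple X i w | i < n].

End process.

Section outer_expectation.
Context (R : realType) (d : measure_display) (Omega : measurableType d).
Variable P : probability Omega R.
Local Open Scope ereal_scope.

(* Meant for nonnegative h. The library's integral of a non-measurable
   nonnegative function is a lower integral, so it cannot play this role. *)
Definition outer_expectation (h : Omega -> \bar R) : \bar R :=
  ereal_inf [set \int[P]_w g w | g in
    [set g : Omega -> \bar R |
      measurable_fun [set: Omega] g /\ forall w, h w <= g w]].

Lemma outer_expectationE (h : Omega -> \bar R) :
  measurable_fun [set: Omega] h -> (forall w, 0 <= h w) ->
  outer_expectation h = \int[P]_w h w.
Proof.
move=> mh h0; apply/eqP; rewrite eq_le; apply/andP; split.
  by apply: ereal_inf_lbound; exists h.
apply: le_ereal_inf_tmp => _ [g [mg hg] <-].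
exact: ge0_le_integral.
Qed.

End outer_expectation.

Section log_likelihood.
Context (R : realType) (Theta U : Type) (f : Theta -> U -> R).
Local Open Scope ereal_scope.

(* extended real valued: log 0 = -oo *)
Definition logf (theta : Theta) (u : U) : \bar R := lne (f theta u)%:E.

Definition mean_logf (n : nat) (x : nat -> U) (theta : Theta) : \bar R :=
  (n%:R^-1)%:E * \sum_(i < n) logf theta (x i).

Definition sup_mean_logf (n : nat) (x : nat -> U) : \bar R :=
  ereal_sup [set mean_logf n x theta | theta in [set: Theta]].

Definition sup_abs_logf (u : U) : \bar R :=
  ereal_sup [set `|logf theta u| | theta in [set: Theta]].

End log_likelihood.

Definition argmax (R : realType) (Theta : Type) (g : Theta -> \bar R) :
  set Theta := [set theta | forall theta', (g theta' <= g theta)%E].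

(* Main.v *)
Require Import Defs.
From mathcomp Require Import all_boot all_order all_algebra.
From mathcomp Require Import all_classical all_reals all_analysis measurable_realfun.
From mathcomp Require Import lra.

Set Implicit Arguments.
Unset Strict Implicit.
Unset Printing Implicit Defensive.

Import Order.TTheory GRing.Theory Num.Theory.
Import numFieldNormedType.Exports.
Local Open Scope classical_set_scope.
Local Open Scope ring_scope.

(** The proof is Wald's compactness argument.  For a set [K] of parameters let
[sup_logf f K u] be the supremum of [log f_theta(u)] over [theta] in [K].  When
[K] is compact, upper semicontinuity of [f] makes this a measurable function
of [u] ([measurable_sup_logf]), and when [K] is nonempty it is dominated by the
supremum of [|log f_theta|], hence integrable.  As [K] runs through the closed
balls shrinking to [theta], the suprema decrease to [log f_theta], so by
dominated convergence the expectation of [sup_logf f K] comes arbitrarily close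
to [E log f_theta] ([expected_sup_logf_lt]).  Hence [theta |-> E log f_theta] is
upper semicontinuous and attains its maximum [M] on the compact space [Theta]
([argmax_expected_logf_neq0]).

A non-maximizer [theta] therefore has a neighbourhood [K] with
[E sup_logf f K < c < M].  By the ergodic theorem, eventually all parameters in
[K] have mean log-likelihood at most [c], whereas the mean log-likelihood of a
maximizer is eventually above some [b > c].  The estimator asymptotically
attains the supremum of the mean log-likelihoods, so it eventually leaves [K]
([ae_thetahat_avoids]).  Compactness upgrades this to any compact set of
non-maximizers ([ae_eventually_avoids_compact]), in particular to the set of
parameters at distance at least [1/(k+1)] from [Theta0].

Only one half of the ergodic theorem is used: if [E h < c], then almost surely
the means of [h] are eventually at most [c] ([ergodic_mean_le]); applied to
[- log f_theta] it also gives lower bounds.  It reduces to the statement that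
an integrable [phi] with negative integral has almost surely bounded Birkhoff
sums ([birkhoff_sums_bounded]).  Writing [M_n] for the maximum of the first
[n+1] Birkhoff sums, one has [M_(n+1) - M_n o T = phi + (M_n o T)^-], where the
left side has nonnegative integral because [T] preserves the measure and [M_n]
increases.  The set where [M_n] is unbounded is invariant, so if it were not
negligible it would have full measure; then [(M_n o T)^-] would tend to [0]
almost everywhere and the integral of [phi] would be nonnegative. *)

(** * Bounded Birkhoff sums *)

Section maximal_inequality.
Context d (S : measurableType d) (R : realType) (mu : probability S R).
Variable T : S -> S.
Hypothesis mT : measurable_fun [set: S] T.
Hypothesis T_preserves : forall A, measurable A -> mu (T @^-1` A) = mu A.
Variable phi : S -> R.
Hypothesis iphi : mu.-integrable [set: S] (EFin \o phi).

Definition birkhoff_sum n x := \sum_(i < n) phi (iter i T x).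

(** The maximum of the Birkhoff sums of lengths [1] to [n + 1].  In this
recursive form the identity [M_(n+1) = phi + max (0, M_n o T)], on which the
argument rests, holds by definition. *)
Fixpoint max_sum n : S -> R :=
  if n is m.+1 then fun x => phi x + Num.max 0 (max_sum m (T x)) else phi.

Lemma birkhoff_sum_le_max n x : birkhoff_sum n.+1 x <= max_sum n x.
Proof.
elim: n x => [|n IH] x; first by rewrite /birkhoff_sum big_ord1.
rewrite /birkhoff_sum big_ord_recl /= lerD2l le_max.
under eq_bigr do rewrite -iterS iterSr.
by rewrite IH orbT.
Qed.

Lemma max_sumS_ge n x : max_sum n x <= max_sum n.+1 x.
Proof.
elim: n x => [|n IH] x; first by rewrite /= lerDl le_max lexx.
rewrite [leLHS]/= [leRHS]/= lerD2l ge_max !le_max lexx /=.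
by rewrite IH orbT.
Qed.

Lemma max_sum_homo x : {homo max_sum ^~ x : m n / (m <= n)%N >-> m <= n}.
Proof. by apply: homo_leq => // [y|n]; [exact: le_trans|exact: max_sumS_ge]. Qed.

Lemma integrable_comp_preserved (g : S -> \bar R) :
  mu.-integrable [set: S] g -> mu.-integrable [set: S] (g \o T).
Proof.
move=> /integrableP[mg fg]; apply/integrableP; split.
  exact: measurableT_comp.
rewrite (_ : (\int[mu]_x _ = \int[pushforward mu T]_x `|g x|)%E); last first.
  rewrite ge0_integral_pushforward//; exact: measurableT_comp.
rewrite (@eq_measure_integral _ _ _ _ mu)//.
by move=> A mA _; exact: T_preserves.
Qed.

Lemma integral_comp_preserved (g : S -> \bar R) :
  mu.-integrable [set: S] g -> (\int[mu]_x g (T x) = \int[mu]_x g x)%E.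
Proof.
move=> ig; have /integrableP[mg _] := ig.
rewrite -(@integral_pushforward _ _ _ _ _ T mT mu setT g)//; last first.
  exact: integrable_comp_preserved.
by apply: eq_measure_integral => A mA _; exact: T_preserves.
Qed.

Lemma integrable_max_sum n : mu.-integrable [set: S] (EFin \o max_sum n).
Proof.
elim: n => //= n IH.
rewrite (_ : EFin \o _ = (EFin \o phi) \+
    (EFin \o (fun x => Num.max 0 (max_sum n (T x)))))//.
apply: integrableD => //.
have iT := integrable_comp_preserved IH.
have /measurable_EFinP mI : measurable_fun [set: S] (EFin \o (max_sum n \o T)).
  exact: measurable_int iT.
apply: (@le_integrable _ _ _ _ _ _ _ ((EFin \o max_sum n) \o T)) => //.
  apply/measurable_EFinP/measurable_maxr; [exact: measurable_cst|exact: mI].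
move=> x _ /=; rewrite lee_fin ger0_norm ?le_max ?lexx//.
by rewrite ge_max normr_ge0 ler_norm.
Qed.

Definition unbounded_sums := [set x | forall c : nat, exists n, c%:R < max_sum n x].

Lemma measurable_unbounded_sums : measurable unbounded_sums.
Proof.
rewrite (_ : unbounded_sums =
    \bigcap_c \bigcup_n [set x | (c%:R : R) < max_sum n x]).
  apply: bigcapT_measurable => c; apply: bigcupT_measurable => n.
  have /measurable_EFinP mM := measurable_int mu (integrable_max_sum n).
  rewrite -[X in measurable X]setTI.
  rewrite [X in measurable X](_ : _ = setT `&` max_sum n @^-1` `]c%:R, +oo[).
    by apply: mM => //; exact: measurable_itv.
  by apply/seteqP; split => x /=; rewrite in_itv/= andbT.
apply/seteqP; split => x h.
  by move=> c _; have [n ?] := h c; exists n.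
by move=> c; have [n _ ?] := h c I; exists n.
Qed.

(** [M_(n+1)] differs from [max (0, M_n o T)] by [phi], which is finite and does
not depend on [n]. *)
Lemma unbounded_sums_invariant : T @^-1` unbounded_sums = unbounded_sums.
Proof.
apply/seteqP; split => x /= h c.
  have [n hn] := h (Num.truncn (Num.max 0 (c%:R - phi x))).+1.
  exists n.+1 => /=; have := lt_trans (truncnS_gt _) hn.
  rewrite gt_max => /andP[_ h2].
  by rewrite -ltrBlDl lt_max h2 orbT.
have [n hn] := h (Num.truncn (Num.max 0 (c%:R + phi x))).+1.
exists n; have := lt_le_trans (lt_trans (truncnS_gt _) hn) (max_sumS_ge n x).
rewrite gt_max => /andP[_] /=; rewrite addrC ltrD2l lt_max => /orP[|//].
by rewrite ltNge ler0n.
Qed.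

(** The integral of [defect n = M_(n+1) - M_n o T] is nonnegative since it
equals that of [M_(n+1) - M_n].  Once [M_n o T] is positive, [defect n] equals
[phi], and it is dominated since [M_n >= M_0 = phi], so the bound passes to the
limit. *)
Lemma integral_ge0_of_unbounded_sums :
  {ae mu, forall x, unbounded_sums x} -> (0 <= \int[mu]_x (phi x)%:E)%E.
Proof.
move=> aeU.
pose defect n x := phi x + Num.max (- max_sum n (T x)) 0.
have defectE n x : defect n x = max_sum n.+1 x - max_sum n (T x).
  rewrite /defect /= -addrA; congr (_ + _).
  by case: (lerP 0 (max_sum n (T x))) => ?;
    case: (lerP (- max_sum n (T x)) 0) => ?; lra.
have iM n := integrable_max_sum n.
have iMT n := integrable_comp_preserved (iM n).
have int_defect n : (0 <= \int[mu]_x (defect n x)%:E)%E.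
  under eq_integral do rewrite defectE EFinB.
  have intT : (\int[mu]_x (max_sum n (T x))%:E = \int[mu]_x (max_sum n x)%:E)%E.
    exact: integral_comp_preserved (iM n).
  rewrite (integralB measurableT (iM n.+1) (iMT n)) intT.
  rewrite sube_ge0; last first.
    by apply/orP; left; exact: (integrable_fin_num measurableT (iM n)).
  apply: (le_integral measurableT (iM n) (iM n.+1)) => x _.
  by rewrite lee_fin max_sumS_ge.
have mphi : measurable_fun [set: S] (EFin \o phi) := measurable_int mu iphi.
have idef n : mu.-integrable [set: S] (EFin \o defect n).
  rewrite (_ : _ \o _ =
      ((EFin \o max_sum n.+1) \- ((EFin \o max_sum n) \o T))%E).
    exact: (integrableB measurableT (iM n.+1) (iMT n)).
  by apply/funext => x /=; rewrite -EFinB -defectE.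
have iphiT := integrable_comp_preserved iphi.
have ig := integrableD measurableT (integrable_abse iphi) (integrable_abse iphiT).
have [||||_ _ cv] := @dominated_convergence _ _ _ mu setT measurableT
  (fun n => EFin \o defect n) (EFin \o phi) _ _ _ _ ig.
- by move=> n; exact: measurable_int (idef n).
- exact: mphi.
- apply: filterS aeU => x Ux _.
  have [N] : exists n, (0%:R : R) < max_sum n (T x).
    by apply: (_ : unbounded_sums (T x)); rewrite -unbounded_sums_invariant in Ux.
  move=> hN; apply: cvg_near_cst; near=> n.
  have hn : 0 < max_sum n (T x).
    by apply: lt_le_trans hN _; apply: max_sum_homo; near: n; exact: nbhs_infty_ge.
  by rewrite /= /defect max_r ?addr0// oppr_le0 ltW.
- apply: nearW => x n _ /=; rewrite lee_fin (le_trans (ler_normD _ _))// lerD2l.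
  rewrite ger0_norm ?le_max ?lexx ?orbT// ge_max normr_ge0 andbT.
  rewrite -[leRHS]normrN.
  by rewrite (le_trans _ (ler_norm _))// lerN2 (@max_sum_homo _ 0%N).
by apply: cvge_to_ge cv _; apply: nearW => n; exact: int_defect.
Unshelve. all: by end_near. Qed.

Lemma birkhoff_sums_bounded :
  (forall A, measurable A -> T @^-1` A = A -> mu A = 0%E \/ mu A = 1%E) ->
  (\int[mu]_x (phi x)%:E < 0)%E ->
  {ae mu, forall x, exists c, forall n, birkhoff_sum n.+1 x <= c}.
Proof.
move=> T_erg phi_lt0.
have mU := measurable_unbounded_sums.
have [U0|U1] := T_erg _ mU unbounded_sums_invariant; last first.
  suff /integral_ge0_of_unbounded_sums : {ae mu, forall x, unbounded_sums x}.
    by rewrite leNgt phi_lt0.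
  exists (~` unbounded_sums); split => //; first exact: measurableC.
  by rewrite probability_setC// U1 subee.
exists unbounded_sums; split => // x /= h c.
apply: contrapT => h2; apply: h; exists c%:R => n.
apply: le_trans (birkhoff_sum_le_max n x) _.
by rewrite leNgt; apply/negP => ?; apply: h2; exists n.
Qed.

End maximal_inequality.

(** * Means along an ergodic transformation *)

Section ergodic_means.
Context d (S : measurableType d) (R : realType) (mu : probability S R).
Variable T : S -> S.
Hypothesis mT : measurable_fun [set: S] T.
Hypothesis T_preserves : forall A, measurable A -> mu (T @^-1` A) = mu A.

Lemma ae_iter_preserved (Z : S -> Prop) i :
  {ae mu, forall x, Z x} -> {ae mu, forall x, Z (iter i T x)}.
Proof.
elim: i Z => // i IH Z /IH [N [mN N0 subN]].
exists (T @^-1` N); split; first by rewrite -[X in measurable X]setTI; exact: mT.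
  by rewrite -N0; exact: T_preserves.
by move=> x /= nZ; apply: subN => /=; rewrite -iterSr.
Qed.

Hypothesis T_ergodic : forall A,
  measurable A -> T @^-1` A = A -> mu A = 0%E \/ mu A = 1%E.

(** With [b] strictly between the integral of [h] and [c], the Birkhoff sums of
[h - b] are almost surely bounded, by [K] say, so the mean of [n] terms is at
most [b + K / n].  Integrability makes [h] finite at almost all iterates, which
allows sums in [\bar R] to be replaced with real ones. *)
Lemma ergodic_mean_le (h : S -> \bar R) (c : R) :
  mu.-integrable [set: S] h -> (\int[mu]_x h x < c%:E)%E ->
  {ae mu, forall x, \forall n \near \oo,
    ((n%:R^-1)%:E * \sum_(i < n) h (iter i T x) <= c%:E)%E}.
Proof.
move=> ih hc.
have h_fin := integrable_fin_num measurableT ih.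
have [b [hb bc]] : exists b, (\int[mu]_x h x < b%:E)%E /\ b < c.
  move: hc; rewrite -(fineK h_fin) lte_fin => hc.
  by exists ((fine (\int[mu]_x h x) + c) / 2); rewrite lte_fin; split; lra.
have aeh := integrable_ae measurableT ih.
have mh : measurable_fun [set: S] h := measurable_int mu ih.
have mfh : measurable_fun [set: S] (fine \o h) by exact: measurableT_comp.
have ifh : mu.-integrable [set: S] (EFin \o (fine \o h)).
  apply: le_integrable ih => //; first exact/measurable_EFinP.
  by move=> x _ /=; case: (h x) => //=; rewrite normr0 leey.
pose phi x := fine (h x) - b.
have phiE : EFin \o phi = ((EFin \o (fine \o h)) \- cst b%:E)%E.
  by apply/funext => x /=; rewrite EFinB.
have icst : mu.-integrable [set: S] (cst b%:E).
  exact: finite_measure_integrable_cst.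
have iphi : mu.-integrable [set: S] (EFin \o phi).
  by rewrite phiE; exact: (integrableB measurableT ifh icst).
have phi_lt0 : (\int[mu]_x (phi x)%:E < 0)%E.
  rewrite (_ : (\int[mu]_x _ =
      \int[mu]_x ((EFin \o (fine \o h)) \- cst b%:E) x)%E); last first.
    by rewrite -phiE.
  rewrite (integralB measurableT ifh icst) integral_cst//.
  rewrite [X in (_ * X)%E](_ : _ = 1%E) ?mule1;
    last exact: probability_setT.
  rewrite sube_lt0 ?orbT// (_ : (\int[mu]_x _ = \int[mu]_x h x)%E)//.
  apply: ae_eq_integral => //; first exact/measurable_EFinP.
  by apply: filterS aeh => x hx _ /=; rewrite fineK// hx.
have aeb := birkhoff_sums_bounded mT T_preserves iphi T_ergodic phi_lt0.
have aefin : {ae mu, forall x, forall i, h (iter i T x) \is a fin_num}.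
  apply: ae_foralln => i; apply: (ae_iter_preserved (Z := fun x => h x \is a fin_num)).
  by apply: filterS aeh => x; exact.
apply: filterS2 aeb aefin => x [K hK] hfin.
near=> n.
have n_gt0 : (0 < n)%N by near: n; exact: nbhs_infty_gt.
under eq_bigr do rewrite -(fineK (hfin _)).
rewrite sumEFin -EFinM lee_fin mulrC ler_pdivrMr ?ltr0n//.
have := hK n.-1; rewrite prednK// /birkhoff_sum /phi sumrB sumr_const card_ord => hKn.
have hn : K <= (c - b) * n%:R.
  rewrite -ler_pdivrMl ?subr_gt0//; near: n; exact: nbhs_infty_ger.
move: hKn hn; rewrite -mulr_natr; lra.
Unshelve. all: by end_near. Qed.

End ergodic_means.

(** * Means of a stationary ergodic process *)

Section stationary_ergodic_process.
Context (R : realType) d d' (Omega : measurableType d) (T : measurableType d').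
Variables (P : probability Omega R) (X : nat -> {RV P >-> T}).

Local Notation path_space := (g_sigma_algebraType
  (\bigcup_i preimage_set_system [set: nat -> T] (fun x => x i) measurable)).

Lemma measurable_coordinate i :
  measurable_fun [set: path_space] (fun x : path_space => x i).
Proof.
move=> _ A mA; apply: sub_sigma_algebra; exists i => //.
by exists A => //; rewrite setTI.
Qed.

Lemma measurable_to_paths d0 (S : measurableType d0) (g : S -> path_space) :
  (forall i, measurable_fun [set: S] (fun x => g x i)) ->
  measurable_fun [set: S] g.
Proof.
move=> mg; apply: measurability => // _ [_ [i _ [A mA <-]] <-].
by rewrite setTI; have := mg i measurableT A mA; rewrite !setTI.
Qed.

Lemma measurable_shift :
  measurable_fun [set: path_space] (@seq_shift _ T : path_space -> path_space).
Proof. by apply: measurable_to_paths => i; exact: measurable_coordinate. Qed.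

Lemma measurable_trajectory :
  measurable_fun [set: Omega] (trajectory X : Omega -> path_space).
Proof. by apply: measurable_to_paths => i; exact: measurable_funP. Qed.

Let traj : {mfun Omega >-> path_space} :=
  MeasurableFun.Pack (MeasurableFun.Class
    (isMeasurableFun.Build _ _ _ _ _ measurable_trajectory)).

Lemma iter_shift i (x : nat -> T) : iter i (@seq_shift _ T) x 0%N = x i.
Proof. by elim: i x => // i IH x; rewrite iterSr IH. Qed.

(** Under the law of the trajectory on path space, the shift is measure
preserving by stationarity, and the process is the first coordinate read along
the iterates of the shift. *)
Lemma stationary_ergodic_mean_le (h : T -> \bar R) (c : R) :
  stationary X -> ergodic X ->
  measurable_fun [set: T] h -> P.-integrable [set: Omega] (h \o X 0%N) ->
  (\int[P]_w h (X 0%N w) < c%:E)%E ->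
  {ae P, forall w, \forall n \near \oo,
    ((n%:R^-1)%:E * \sum_(i < n) h (X i w) <= c%:E)%E}.
Proof.
move=> statX ergX mh ih hc.
pose mu := distribution P traj.
have mh0 : measurable_fun [set: path_space] (fun x : path_space => h (x 0%N)).
  by apply: measurableT_comp => //; exact: measurable_coordinate.
have [||||N [mN N0 subN]] := @ergodic_mean_le _ _ _ mu (@seq_shift _ T)
    measurable_shift _ _ (fun x => h (x 0%N)) c.
- by move=> A mA; exact: statX.
- by move=> A mA invA; exact: ergX.
- exact: integrable_pushforward.
- by rewrite integral_distribution.
exists (traj @^-1` N); split.
- by rewrite -[X in measurable X]setTI; exact: measurable_trajectory.
- by rewrite -N0.
- move=> w nw; apply: subN => /= h2; apply: nw; apply: filterS h2 => n /=.
  by under eq_bigr do rewrite iter_shift.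
Qed.

End stationary_ergodic_process.

(** * Suprema of the log-likelihood over sets of parameters *)

Lemma ereal_dense (R : realType) (x y : \bar R) :
  (x < y)%E -> exists r : R, (x < r%:E < y)%E.
Proof.
move: x y => [x| |] [y| |]// xy.
- by exists ((x + y) / 2); move: xy; rewrite !lte_fin => xy; apply/andP; split; lra.
- by exists (x + 1); rewrite lte_fin ltrDl ltr01 ltry.
- by exists (y - 1); rewrite lte_fin ltrBlDl ltrDr ltr01 ltNyr.
- by exists 0; rewrite ltNyr ltry.
Qed.

Section log_supremum.
Context (R : realType) (Theta U : Type) (f : Theta -> U -> R).

Definition sup_logf (K : set Theta) (u : U) : \bar R :=
  ereal_sup [set logf f theta u | theta in K].

Lemma sup_logf1 theta u : sup_logf [set theta] u = logf f theta u.
Proof. by rewrite /sup_logf image_set1 ereal_sup1. Qed.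

Lemma logf_le_sup K theta u : K theta -> (logf f theta u <= sup_logf K u)%E.
Proof. by move=> Kt; apply: ereal_sup_ubound; exists theta. Qed.

Lemma lt_logf (y : R) theta u : (y%:E < logf f theta u)%E = (expR y < f theta u).
Proof.
rewrite /logf; have [f0|f0] := lerP (f theta u) 0.
  rewrite le0_lneNy ?lee_fin// ltNge leNye/=.
  by apply/esym/negbTE; rewrite -leNgt (le_trans f0)// expR_ge0.
by rewrite lne_EFin// lte_fin -[LHS]ltr_expR lnK.
Qed.

Lemma logf_lt (y : R) theta u : (logf f theta u < y%:E)%E = (f theta u < expR y).
Proof.
rewrite /logf; have [f0|f0] := lerP (f theta u) 0.
  by rewrite le0_lneNy ?lee_fin// ltNyr (le_lt_trans f0) ?expR_gt0.
by rewrite lne_EFin// lte_fin -[LHS]ltr_expR lnK.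
Qed.

Lemma logf_lty theta u : (logf f theta u < +oo)%E.
Proof.
rewrite /logf; have [f0|f0] := lerP (f theta u) 0.
  by rewrite le0_lneNy ?lee_fin.
by rewrite lne_EFin// ltry.
Qed.

Lemma lt_sup_logf (y : R) K u :
  (y%:E < sup_logf K u)%E <-> exists2 theta, K theta & expR y < f theta u.
Proof.
split=> [/ereal_sup_gt[_ [theta Kt <-]]|[theta Kt h]].
  by rewrite lt_logf => h; exists theta.
by apply: lt_le_trans (logf_le_sup u Kt); rewrite lt_logf.
Qed.

Lemma abs_sup_logf_le K u :
  K !=set0 -> (`|sup_logf K u| <= sup_abs_logf f u)%E.
Proof.
move=> [theta Kt]; have ub t : (`|logf f t u| <= sup_abs_logf f u)%E.
  by apply: ereal_sup_ubound; exists t.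
have [s0|s0] := leP 0%E (sup_logf K u).
  rewrite gee0_abs//; apply: ge_ereal_sup => _ [t _ <-].
  exact: le_trans (lee_abs _) (ub t).
rewrite lte0_abs//; apply: le_trans (ub theta); rewrite -abseN.
by apply: le_trans (lee_abs _); rewrite leeN2 logf_le_sup.
Qed.

End log_supremum.

Section log_supremum_measurable.
Context (R : realType) (Theta : topologicalType) (U : ptopologicalType).
Variable f : Theta -> U -> R.
Hypothesis f_usc : upper_semicontinuous (fun z : Theta * U => f z.1 z.2).

(** The tube lemma: the inequality holds in a neighbourhood of [(theta, u)] for
every [theta] in [K], and finitely many of these cover [K]. *)
Lemma open_uniform_lt (K : set Theta) (a : R) :
  compact K -> open [set u | forall theta, K theta -> f theta u < a].
Proof.
move=> /compact_near_coveringP cK; rewrite openE => u hu.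
apply: (cK U (nbhs u) (fun u theta => f theta u < a)) => theta Kt.
exact: (@f_usc (theta, u) a (hu theta Kt)).
Qed.

(** [sup_logf f K u <= x] holds exactly when [f theta u <= expR x] for all
[theta] in [K].  Only strict bounds define open sets, whence the countable intersection over the
bounds [expR x + 1 / (k + 1)]. *)
Lemma measurable_sup_logf (K : set Theta) :
  compact K -> measurable_fun [set: Borel U] (sup_logf f K).
Proof.
move=> cK; apply: (measurability _ (ErealGenOInfty.measurableE R)).
move=> _ [_ [x ->] <-]; rewrite setTI preimage_itvoy.
rewrite -[X in measurable X]setCK; apply: measurableC.
rewrite (_ : ~` _ = \bigcap_k [set u | forall theta, K theta ->
    f theta u < expR x + k.+1%:R^-1]).
  apply: bigcapT_measurable => k; apply: sub_sigma_algebra.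
  exact: open_uniform_lt.
apply/seteqP; split => [u /= h k _ theta Kt|u /= h /lt_sup_logf[theta Kt]].
  rewrite ltNge; apply/negP => h2; apply: h; apply/lt_sup_logf; exists theta => //.
  by apply: lt_le_trans h2; rewrite ltrDl invr_gt0.
apply/negP; rewrite -leNgt; apply/ler_addgt0Pr => e e0.
have /(_ (Num.truncn e^-1)) := h _ I _ Kt => /ltW /le_trans; apply.
rewrite lerD2l invf_ple ?posrE//; apply/ltW; exact: truncnS_gt.
Qed.

Lemma measurable_logf theta : measurable_fun [set: Borel U] (logf f theta).
Proof.
rewrite (_ : logf f theta = sup_logf f [set theta]).
  by apply: measurable_sup_logf; exact: compact_set1.
by apply/funext => u; rewrite sup_logf1.
Qed.

End log_supremum_measurable.

(** * The expected log-likelihood and its maximizers *)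

Section expected_log_supremum.
Context (R : realType) (Theta : metricType R) (U : ptopologicalType).
Variable f : Theta -> U -> R.
Hypothesis f_usc : upper_semicontinuous (fun z : Theta * U => f z.1 z.2).
Hypothesis compactTheta : compact [set: Theta].
Context d (Omega : measurableType d) (P : probability Omega R).
Variable V : {RV P >-> Borel U}.
Hypothesis sup_finite :
  (outer_expectation P (fun w => sup_abs_logf f (V w)) < +oo)%E.

Let compact_closed (K : set Theta) : closed K -> compact K.
Proof. by move=> cK; apply: subclosed_compact cK compactTheta _. Qed.

Lemma dominating_function : [set: Theta] !=set0 ->
  exists g : Omega -> \bar R, P.-integrable [set: Omega] g /\
    forall w, (sup_abs_logf f (V w) <= g w)%E.
Proof.
move=> [theta _]; have [_ [g [mg hg] <-] gfin] := ereal_inf_lt sup_finite.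
exists g; split => //; apply/integrableP; split => //.
rewrite (_ : (\int[P]_w _ = \int[P]_w g w)%E)//.
apply: eq_integral => w _; rewrite gee0_abs//; apply: le_trans (hg w).
apply: le_trans (abs_sup_logf_le f (V w) (_ : [set theta] !=set0)) => //.
by exists theta.
Qed.

Lemma integrable_sup_logf (K : set Theta) : compact K -> K !=set0 ->
  P.-integrable [set: Omega] (sup_logf f K \o V).
Proof.
move=> cK K0; have [|g [ig hg]] := dominating_function.
  by case: K0 => theta _; exists theta.
apply: le_integrable ig => //.
  by apply: measurableT_comp => //; exact: measurable_sup_logf.
move=> w _ /=; apply: le_trans (lee_abs _); apply: le_trans (hg w).
exact: abs_sup_logf_le.
Qed.

Lemma integrable_logf theta : P.-integrable [set: Omega] (logf f theta \o V).
Proof.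
rewrite (_ : logf f theta = sup_logf f [set theta]).
  by apply: integrable_sup_logf; [exact: compact_set1|exists theta].
by apply/funext => u; rewrite sup_logf1.
Qed.

Local Notation cball theta n := (@closed_ball R Theta theta n.+1%:R^-1).

Let center theta n : (cball theta n) theta.
Proof. by apply: closed_ballxx; rewrite invr_gt0. Qed.

Lemma closed_ball_eventually_sub theta A : nbhs theta A ->
  \forall n \near \oo, cball theta n `<=` A.
Proof.
move=> /nbhs_ballP[e /= e0 eA]; have e20 : 0 < e / 2 by rewrite divr_gt0.
near=> n.
apply: subset_trans eA.
apply: (subset_trans _ (@subset_closure_half _ _ theta e e0)).
 apply: le_closed_ball.
apply/ltW; near: n; exact: (near_infty_natSinv_lt (PosNum e20)).
Unshelve. all: by end_near. Qed.

(** The suprema decrease with the balls.  Their limit exceeds no real [y] above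
[log f_theta(u)], because [f t u < expR y] holds for [t] near [theta]. *)
Lemma sup_logf_closed_ball_cvg theta u :
  sup_logf f (cball theta n) u @[n --> \oo] --> logf f theta u.
Proof.
have -> : logf f theta u = ereal_inf (range (fun n => sup_logf f (cball theta n) u)).
  apply/eqP; rewrite eq_le; apply/andP; split.
    by apply: le_ereal_inf_tmp => _ [n _ <-]; exact/logf_le_sup/center.
  rewrite leNgt; apply/negP => lt_inf.
  have [y /andP[]] := ereal_dense lt_inf.
  move=> ly; apply/negP; rewrite -leNgt.
  have : nbhs theta [set t | f t u < expR y].
    have fy : f theta u < expR y by rewrite -logf_lt.
    have [[A B] /= [nA nB] AB] := @f_usc (theta, u) _ fy.
    apply: filterS nA => t At; apply: (AB (t, u)); split => //=.
    exact: nbhs_singleton.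
  move=> /closed_ball_eventually_sub[N _ /(_ N (leqnn N)) sub].
  apply: (@le_trans _ _ (sup_logf f (cball theta N) u)).
    by apply: ereal_inf_lbound; exists N.
  rewrite leNgt; apply/negP => /lt_sup_logf[t /sub /= ft].
  by rewrite ltNge (ltW ft).
apply: ereal_nonincreasing_cvgn => m n mn.
apply: ereal_sup_le; apply: image_subset.
apply: le_closed_ball.
by rewrite lef_pV2 ?posrE// ler_nat.
Qed.

(** This is the local form of upper semicontinuity of the expected
log-likelihood, with one random variable dominating all the log-likelihoods
near [theta], so that the ergodic theorem can be applied to it. *)
Lemma expected_sup_logf_lt theta (c : \bar R) :
  (\int[P]_w logf f theta (V w) < c)%E ->
  exists K, [/\ compact K, nbhs theta K &
    (\int[P]_w sup_logf f K (V w) < c)%E].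
Proof.
move=> hc; have [|g [ig hg]] := dominating_function; first by exists theta.
have cK n : compact (cball theta n).
  by apply: compact_closed; exact: closed_ball_closed.
have [||||_ _ cv] := @dominated_convergence _ _ _ P setT measurableT
  (fun n => sup_logf f (cball theta n) \o V)
  (logf f theta \o V) _ _ _ _ ig.
- by move=> n; apply: measurableT_comp => //; exact: measurable_sup_logf.
- by apply: measurableT_comp => //; exact: measurable_logf.
- by apply: nearW => w _; exact: sup_logf_closed_ball_cvg.
- apply: nearW => w n _ /=; apply: le_trans (hg w); apply: abs_sup_logf_le.
  by exists theta; exact: center.
have [N _ /(_ N (leqnn N)) hN] := cv _ (open_ereal_lt' hc).
exists (cball theta N); split => //.
apply: filterS (nbhsx_ballx theta N.+1%:R^-1 _); last by rewrite invr_gt0.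
exact: subset_closed_ball.
Qed.

Lemma expected_logf_le_sup K theta : compact K -> K theta ->
  (\int[P]_w logf f theta (V w) <= \int[P]_w sup_logf f K (V w))%E.
Proof.
move=> cK Kt; have K0 : K !=set0 by exists theta.
apply: (le_integral measurableT (integrable_logf theta)
  (integrable_sup_logf cK K0)) => w _.
exact: logf_le_sup.
Qed.

(** If the supremum [s] were not attained, every [theta] would have a
neighbourhood on which the expected log-likelihood stays below [s - 1 / (n + 1)]
for large [n]; by compactness one [n] would do for all [theta]. *)
Lemma argmax_expected_logf_neq0 : [set: Theta] !=set0 ->
  argmax (fun theta => \int[P]_w logf f theta (V w))%E !=set0.
Proof.
move=> Theta0; pose E theta := (\int[P]_w logf f theta (V w))%E.
have Efin t : E t \is a fin_num.
  exact: (integrable_fin_num measurableT (integrable_logf t)).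
pose s := ereal_sup (range E).
have Es t : (E t <= s)%E by apply: ereal_sup_ubound; exists t.
have [t0 _] := Theta0.
have s_lty : (s < +oo)%E.
  have sT : (s <= \int[P]_w sup_logf f setT (V w))%E.
    by apply: ge_ereal_sup => _ [t _ <-]; exact: expected_logf_le_sup.
  apply: le_lt_trans sT _; rewrite ltey_eq.
  by rewrite (integrable_fin_num measurableT (integrable_sup_logf compactTheta Theta0)).
have s_fin : s \is a fin_num.
  by rewrite fin_numE gt_eqF ?lt_eqF// (lt_le_trans _ (Es t0))// ltNye_eq Efin.
apply: contrapT => noargmax.
have Elts t : (E t < s)%E.
  rewrite lt_neqAle Es andbT; apply/eqP => Et; apply: noargmax; exists t => t' /=.
  by rewrite -/(E t') -/(E t) Et.
move/compact_near_coveringP : compactTheta.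
move=> /(_ nat \oo (fun n t => (E t < (fine s - n.+1%:R^-1)%:E)%E) _)[].
  move=> t _; have [r /andP[Er rs]] := ereal_dense (Elts t).
  have [K [cK nK hK]] := expected_sup_logf_lt Er.
  have : \forall n \near \oo, r <= fine s - n.+1%:R^-1.
    have rs0 : 0 < fine s - r.
      by move: rs; rewrite -{1}(fineK s_fin) lte_fin subr_gt0.
    near=> n; rewrite lerBrDr -lerBrDl; apply/ltW.
    near: n; exact: (near_infty_natSinv_lt (PosNum rs0)).
  move=> rn; exists (K, [set n | r <= fine s - n.+1%:R^-1]) => //= -[t' n] /= [Kt' hn].
  apply: le_lt_trans (expected_logf_le_sup cK Kt') _.
  by apply: lt_le_trans hK _; rewrite lee_fin.
move=> N _ /(_ N (leqnn N)) /= hN.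
have : (s <= (fine s - N.+1%:R^-1)%:E)%E.
  by apply: ge_ereal_sup => _ [t _ <-]; exact/ltW/hN.
by rewrite -{1}(fineK s_fin) lee_fin leNgt gtrBl invr_gt0 ltr0n.
Unshelve. all: by end_near. Qed.

End expected_log_supremum.

(** * Transfer between random variables with the same law *)

Section same_law.
Context (R : realType) d (T : measurableType d).
Context d1 (Omega1 : measurableType d1) (P1 : probability Omega1 R).
Context d2 (Omega2 : measurableType d2) (P2 : probability Omega2 R).
Variables (X : {RV P1 >-> T}) (Y : {RV P2 >-> T}).
Hypothesis same_law : forall A, measurable A ->
  distribution P1 X A = distribution P2 Y A.
Variable h : T -> \bar R.
Hypothesis mh : measurable_fun [set: T] h.
Hypothesis ihX : P1.-integrable [set: Omega1] (h \o X).

Lemma integrable_same_law : P2.-integrable [set: Omega2] (h \o Y).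
Proof.
apply/integrableP; split; first exact: measurableT_comp.
have mah : measurable_fun [set: T] (fun x => `|h x|)%E.
  exact: measurableT_comp.
have eX := ge0_integral_distribution X mah (fun=> abse_ge0 _).
have eY := ge0_integral_distribution Y mah (fun=> abse_ge0 _).
have /integrableP[_] := ihX; rewrite -[X in (X < _)%E -> _]eX
  -[X in _ -> (X < _)%E]eY.
rewrite (@eq_measure_integral _ _ _ _ (distribution P2 Y))//.
by move=> A mA _; exact: same_law.
Qed.

Lemma integral_same_law : (\int[P1]_w h (X w) = \int[P2]_w h (Y w))%E.
Proof.
rewrite -(integral_distribution mh ihX).
rewrite -(integral_distribution mh integrable_same_law).
by apply: eq_measure_integral => A mA _; exact: same_law.
Qed.

End same_law.

(** * Consistency *)

Section consistency.
Context (R : realType) (Theta : metricType R) (U : ptopologicalType).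
Variable f : Theta -> U -> R.
Hypothesis f_usc : upper_semicontinuous (fun z : Theta * U => f z.1 z.2).
Hypothesis compactTheta : compact [set: Theta].
Context d (Omega : measurableType d) (P : probability Omega R).
Variable X : nat -> {RV P >-> Borel U}.
Hypotheses (X_stationary : stationary X) (X_ergodic : ergodic X).
Context d' (Omega' : measurableType d') (P' : probability Omega' R).
Variable V : {RV P' >-> Borel U}.
Hypothesis V_law : forall A, measurable A ->
  distribution P' V A = distribution P (X 0%N) A.
Hypothesis sup_finite :
  (outer_expectation P' (fun w => sup_abs_logf f (V w)) < +oo)%E.

Let Theta0 := argmax (fun theta => \int[P']_w logf f theta (V w))%E.

Lemma ae_mean_logf_ge theta (c : R) :
  (c%:E < \int[P']_w logf f theta (V w))%E ->
  {ae P, forall w, \forall n \near \oo,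
    (c%:E <= mean_logf f n (trajectory X w) theta)%E}.
Proof.
move=> hc.
have ml := measurable_logf f_usc theta.
have ilV := integrable_logf f_usc sup_finite theta.
have il := integrable_same_law V_law ml ilV.
have mN : measurable_fun [set: Borel U] (fun u => - logf f theta u)%E.
  exact: measurableT_comp.
have hN : (\int[P]_w (- logf f theta (X 0%N w)) < (- c)%:E)%E.
  rewrite (integralN (integrable_add_def measurableT il)).
  by rewrite EFinN lteN2 -(integral_same_law V_law ml ilV).
have := stationary_ergodic_mean_le X_stationary X_ergodic mN
  (integrableN il) hN.
apply: filterS => w; apply: filterS => n.
(* the logarithms may be [-oo] but never [+oo], so the sum can be negated *)
rewrite sumeN; last first.
  by move=> i j _ _; rewrite /adde_def !(lt_eqF (logf_lty _ _ _)) !andbF.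
by rewrite muleN EFinN leeN2.
Qed.

Lemma ae_mean_sup_logf_le K (c : R) : compact K -> K !=set0 ->
  (\int[P']_w sup_logf f K (V w) < c%:E)%E ->
  {ae P, forall w, \forall n \near \oo, forall theta, K theta ->
    (mean_logf f n (trajectory X w) theta <= c%:E)%E}.
Proof.
move=> cK K0 hc.
have mK := measurable_sup_logf f_usc cK.
have iKV := integrable_sup_logf f_usc sup_finite cK K0.
have := stationary_ergodic_mean_le X_stationary X_ergodic mK
  (integrable_same_law V_law mK iKV) (c := c).
rewrite -(integral_same_law V_law mK iKV) => /(_ hc).
apply: filterS => w; apply: filterS => n hn theta Kt.
apply: le_trans hn; apply: lee_wpmul2l; first by rewrite lee_fin invr_ge0.
by apply: lee_sum => i _; exact: logf_le_sup.
Qed.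

Variable thetahat : nat -> Omega -> Theta.
Hypothesis thetahat_maximizes : {ae P, forall w, exists l : \bar R,
  mean_logf f n (trajectory X w) (thetahat n w) @[n --> \oo] --> l /\
  sup_mean_logf f n (trajectory X w) @[n --> \oo] --> l}.

(** The levels [c < b] separate [theta] from a maximizer [theta0]: the limit [l]
is at least [b] because the supremum dominates [theta0], while all of [K] stays
at most at [c]. *)
Lemma ae_thetahat_avoids theta : Theta0 !=set0 -> ~ Theta0 theta ->
  exists2 K, nbhs theta K &
    {ae P, forall w, \forall n \near \oo, ~ K (thetahat n w)}.
Proof.
move=> [theta0 Th0] nTh.
have : (\int[P']_w logf f theta (V w) < \int[P']_w logf f theta0 (V w))%E.
  rewrite ltNge; apply/negP => h; apply: nTh => t /=.
  exact: le_trans (Th0 t) h.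
move=> /ereal_dense[c /andP[tc /ereal_dense[b /andP[cb bM]]]].
have [K [cK nK Kc]] := expected_sup_logf_lt f_usc compactTheta sup_finite tc.
have K0 : K !=set0 by exists theta; exact: nbhs_singleton.
exists K => //.
have ae1 := ae_mean_sup_logf_le cK K0 Kc.
have ae2 := ae_mean_logf_ge bM.
apply: filterS3 ae1 ae2 thetahat_maximizes => w w1 w2 [l [wl wsup]].
have bl : (b%:E <= l)%E.
  apply: (cvge_to_ge wsup); apply: filterS w2 => n /le_trans; apply.
  by apply: ereal_sup_ubound; exists theta0.
have cl : \forall n \near \oo,
    (c%:E < mean_logf f n (trajectory X w) (thetahat n w))%E.
  exact: wl _ (open_ereal_gt' (lt_le_trans cb bl)).
apply: filterS2 w1 cl => n h1 h2 /h1.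
by rewrite leNgt h2.
Qed.

(** Each point of [K] has its own negligible set and its own rank.  Covering
compactness is applied along the filter [F] of the properties that hold almost
surely for all large [n], which absorbs both. *)
Lemma ae_eventually_avoids_compact (K : set Theta) :
  Theta0 !=set0 -> compact K -> K `&` Theta0 = set0 ->
  {ae P, forall w, \forall n \near \oo, ~ K (thetahat n w)}.
Proof.
move=> Th0 /compact_near_coveringP cK KTh.
pose F : set_system (Omega * nat) :=
  [set S | {ae P, forall w, \forall n \near \oo, S (w, n)}].
have FF : Filter F.
  split.
  - by apply: nearW => w; exact: nearW.
  - move=> A B hA hB; apply: (@filterS2 _ (almost_everywhere P)) hA hB => w.
    exact: (@filterS2 _ \oo).
  - move=> A B AB; apply: (@filterS _ (almost_everywhere P)) => w.
    by apply: (@filterS _ \oo) => n; exact: AB.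
have := cK _ F (fun i theta => thetahat i.2 i.1 <> theta) FF.
have : forall x, K x -> \forall x' \near x & i \near F, thetahat i.2 i.1 <> x'.
  move=> x Kx; have nTh : ~ Theta0 x.
    by move=> Tx; have : (K `&` Theta0) x by []; rewrite KTh.
  have [B nB hB] := ae_thetahat_avoids Th0 nTh.
  exists (B, [set i | ~ B (thetahat i.2 i.1)]) => //= -[x' i] /= [Bx' nBi] eqx.
  by apply: nBi; rewrite eqx.
move=> h /(_ h); apply: (@filterS _ (almost_everywhere P)) => w.
by apply: (@filterS _ \oo) => n /= hK Kn; exact: hK Kn erefl.
Qed.

Lemma ae_dist_argmax_cvg0 : Theta0 !=set0 ->
  {ae P, forall w, edist_inf Theta0 (thetahat n w) @[n --> \oo] --> 0%E}.
Proof.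
move=> Th0.
have : {ae P, forall w, forall k : nat, \forall n \near \oo,
    (edist_inf Theta0 (thetahat n w) < (k.+1%:R^-1)%:E)%E}.
  apply: ae_foralln => k.
  pose K := [set t | ((k.+1%:R^-1)%:E <= edist_inf Theta0 t)%E].
  have cK : compact K.
    apply: subclosed_compact compactTheta _ => //.
    apply: (@preimage_closed _ _ (edist_inf Theta0)
        [set x | ((k.+1%:R^-1)%:E <= x)%E]).
      by move=> ? _; exact: edist_inf_continuous.
    exact: closed_ereal_le_ereal.
  have KTh : K `&` Theta0 = set0.
    apply/seteqP; split => // t [+ Tt]; rewrite /K /= edist_inf0//.
    by rewrite lee_fin leNgt invr_gt0 ltr0n.
  apply: filterS (ae_eventually_avoids_compact Th0 cK KTh) => w.
  by apply: filterS => n /= /negP; rewrite -ltNge.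
apply: filterS => w hw.
apply/fine_cvgP; split.
  apply: filterS (hw 0%N) => n hn.
  by rewrite ge0_fin_numE ?edist_inf_ge0// (lt_trans hn)// ltry.
apply/cvgr0Pnorm_lt => e e0.
have [k hk] : exists k : nat, k.+1%:R^-1 <= e.
  exists (Num.truncn e^-1); rewrite invf_ple ?posrE//; apply/ltW; exact: truncnS_gt.
near=> n.
have : (edist_inf Theta0 (thetahat n w) < (k.+1%:R^-1)%:E)%E.
  by near: n; exact: hw.
have := edist_inf_ge0 Theta0 (thetahat n w).
rewrite /=; case: (edist_inf _ _) => //= r; rewrite lee_fin lte_fin => r0 rk.
by rewrite ger0_norm//; exact: lt_le_trans rk hk.
Unshelve. all: by end_near. Qed.

End consistency.

Theorem theorem4p1
  (R : realType)
  (U : ptopologicalType) (polishU : polish R U)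
  (Theta : metricType R)
  (Theta_neq0 : [set: Theta] !=set0) (compactTheta : compact [set: Theta])
  (Q : {measure set (Borel U) -> \bar R})
  (f : Theta -> U -> R)
  (f_density : forall theta, is_density Q (f theta))
  (f_usc : upper_semicontinuous (fun z : Theta * U => f z.1 z.2))
  (d : measure_display) (Omega : measurableType d) (P : probability Omega R)
  (X : nat -> {RV P >-> Borel U})
  (X_stationary : stationary X) (X_ergodic : ergodic X)
  (d' : measure_display) (Omega' : measurableType d')
  (P' : probability Omega' R) (V : {RV P' >-> Borel U})
  (V_law : forall A, measurable A ->
    distribution P' V A = distribution P (X 0%N) A)
  (theta_ : forall n : nat, n.-tuple (Borel U) -> Theta)
  (theta_measurable : forall n, (1 <= n)%N -> borel_measurable (theta_ n))
  (thetahat := fun (n : nat) (w : Omega) => theta_ n (sample X n w))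
  (theta_maximizes : {ae P, forall w, exists l : \bar R,
    mean_logf f n (trajectory X w) (thetahat n w) @[n --> \oo] --> l /\
    sup_mean_logf f n (trajectory X w) @[n --> \oo] --> l})
  (sup_finite :
    (outer_expectation P' (fun w => sup_abs_logf f (V w)) < +oo)%E)
  (Theta0 := argmax (fun theta => \int[P']_w logf f theta (V w))%E) :
  Theta0 !=set0 /\
  {ae P, forall w, edist_inf Theta0 (thetahat n w) @[n --> \oo] --> 0%E}.
Proof.
have Theta0_neq0 : Theta0 !=set0.
  exact: argmax_expected_logf_neq0.
split => //.
exact: (ae_dist_argmax_cvg0 f_usc compactTheta X_stationary X_ergodic V_law
  sup_finite theta_maximizes).
Qed.
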